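(* Let $T,U\in\mathcal{GB}(H)$, let $\Lambda_{TU}=\{(W_j,\Lambda_j,v_j)\}_{j\in J}$ be a $(T,U)$-controlled $g$-fusion frame for $H$ with frame bounds $A,B$, and let $S_C$ be its corresponding frame operator. Assume that $S_C^{-1}$ commutes with $T$ and $U$. Then the family $\{v_j^2T^*P_{W_j}\Lambda_j^*T_jU\}_{j\in J}$ is a resolution of the identity operator on $H$, where $T_j=\Lambda_jP_{W_j}S_C^{-1}$ for $j\in J$. Furthermore, for each $f\in H$, $$\frac{A}{B^2}\|f\|^2\le\sum_{j\in J}v_j^2\langle T_jUf,\ T_jTf\rangle\le\frac{B}{A^2}\|f\|^2.$$
   Context: $H$ is a separable Hilbert space, $J\subset\mathbb{Z}$, $\{H_j\}_{j\in J}$ is a collection of Hilbert spaces, $\{W_j\}_{j\in J}$ are closed subspaces of $H$, $\{v_j\}_{j\in J}$ are positive weights, and $\Lambda_j\in\mathcal{B}(H,H_j)$ (bounded linear operators). $\mathcal{GB}(H)$ is the set of bounded linear operators on $H$ having a bounded inverse. $P_M$ is the orthogonal projection onto a closed subspace $M$. The family $\Lambda_{TU}$ is a $(T,U)$-controlled $g$-fusion frame for $H$ with bounds $A,B$ if $0<A\le B<\infty$ and $$A\|f\|^2\le \sum_{j\in J} v_j^2\langle \Lambda_jP_{W_j}Uf,\Lambda_jP_{W_j}Tf\rangle\le B\|f\|^2\quad\text{for all } f\in H.$$ Its frame operator is $S_Cf=\sum_{j\in J}v_j^2T^*P_{W_j}\Lambda_j^*\Lambda_jP_{W_j}Uf$,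 $f\in H$; it is a bounded, self-adjoint, positive, invertible operator with $A I_H\le S_C\le B I_H$. A family of bounded operators $\{R_j\}_{j\in J}$ on $H$ is a resolution of the identity operator on $H$ if $f=\sum_{j\in J}R_j(f)$ for all $f\in H$, with the series converging unconditionally for every $f\in H$. *)

(* Defs.v *)
From HB Require Import structures.
From mathcomp Require Import all_boot all_order all_algebra finmap.
From mathcomp Require Import complex.
From mathcomp Require Import all_classical all_reals all_analysis.

Set Implicit Arguments.
Unset Strict Implicit.
Unset Printing Implicit Defensive.

Import Order.TTheory GRing.Theory Num.Theory.
Import numFieldNormedType.Exports.

#[global] Open Scope classical_set_scope.
#[global] Open Scope ring_scope.
#[global] Open Scope complex_scope.

(* Complex Hilbert spaces: the inner product is linear in its first argument
   and conjugate-linear in the second. *)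
HB.mixin Record CompleteNormedModule_isHilbert (R : realType) H
    & CompleteNormedModule R[i] H := {
  innerp : {dot H for (@Num.conj R[i])} ;
  innerp_norm : forall f : H, innerp f f = `|f| ^+ 2
}.

#[short(type="hilbertType")]
HB.structure Definition Hilbert (R : realType) :=
  {H of CompleteNormedModule_isHilbert R H & CompleteNormedModule R[i] H}.

Definition inner (R : realType) (H : hilbertType R) (f g : H) : R[i] :=
  innerp f g.

Definition separable_space (X : topologicalType) : Prop :=
  exists D : set X, countable D /\ dense D.

Definition closed_subspace (R : realType) (H : hilbertType R) (W : set H) :=
  [/\ closed W, W 0 & forall (a : R[i]) x y, W x -> W y -> W (a *: x + y)].

Section Operators.
Variables (R : realType) (H K : hilbertType R).

Definition bounded_operator (T : H -> K) : Prop :=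
  linear T /\ exists M : R, forall f, `|T f| <= M%:C * `|f|.

(* By the Riesz theorem, a bounded T satisfies this equation with exactly one
   value of h for each g. *)
Definition adjoint (T : H -> K) (g : K) : H :=
  xget 0 [set h | forall f, inner (T f) g = inner f h].

Definition inverse_op (T : H -> K) (g : K) : H := xget 0 [set f | T f = g].

(* The orthogonal projection onto W when W is a closed subspace. *)
Definition orthogonal_proj (W : set H) (f : H) : H :=
  xget 0 [set p | W p /\ forall w, W w -> inner (f - p) w = 0].

End Operators.

Definition bounded_invertible (R : realType) (H : hilbertType R)
    (T : H -> H) : Prop :=
  bounded_operator T /\
  exists T' : H -> H, [/\ bounded_operator T', cancel T T' & cancel T' T].

(* Unordered sums over an arbitrary index type: limits of the net of finite
   partial sums, indexed by the finite sets ordered by inclusion. *)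
Section UnorderedSums.
Local Open Scope fset_scope.

Definition finite_sets (I : choiceType) : set_system {fset I} :=
  [set S | exists A : {fset I}, forall B : {fset I}, A `<=` B -> S B].

#[global] Instance finite_sets_proper_filter (I : choiceType) :
  ProperFilter (@finite_sets I).
Proof.
apply: Build_ProperFilter_ex.
  by move=> P [A AP]; exists A; exact: AP.
split.
- by exists fset0.
- move=> P Q [A AP] [B BQ]; exists (A `|` B) => C ABC; split.
    by apply: AP; apply: fsubset_trans ABC; exact: fsubsetUl.
  by apply: BQ; apply: fsubset_trans ABC; exact: fsubsetUr.
- by move=> P Q PQ [A AP]; exists A => B /AP /PQ.
Qed.

Variables (C : numFieldType) (V : normedModType C) (I : choiceType).
Implicit Types (x : I -> V) (s : V).

Definition partial_sum x (A : {fset I}) : V := \sum_(i <- A) x i.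

Definition unconditionally_converges_to x s : Prop :=
  partial_sum x A @[A --> @finite_sets I] --> s.

Definition unconditionally_converges x : Prop :=
  cvg (partial_sum x A @[A --> @finite_sets I]).

(* Meaningful when x converges unconditionally. *)
Definition usum x : V := lim (partial_sum x A @[A --> @finite_sets I]).

End UnorderedSums.

Section ControlledGFusionFrames.
Variables (R : realType) (H : hilbertType R) (J : set int).
Variables (Hj : J -> hilbertType R).
Variables (T U : H -> H).
Variables (W : J -> set H) (Lam : forall j, H -> Hj j) (v : J -> R).

Definition controlled_term (f : H) (j : J) : R[i]^o :=
  (v j ^+ 2)%:C *
  inner (Lam j (orthogonal_proj (W j) (U f)))
        (Lam j (orthogonal_proj (W j) (T f))).

(* The order on R[i] only compares numbers with the same imaginary part, so
   the inequalities include that the sum is real. *)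
Definition controlled_gfusion_frame (A B : R) : Prop :=
  [/\ 0 < A, A <= B & forall f : H,
    [/\ unconditionally_converges (controlled_term f),
        A%:C * `|f| ^+ 2 <= usum (controlled_term f)
      & usum (controlled_term f) <= B%:C * `|f| ^+ 2]].

Definition frame_operator (f : H) : H :=
  usum (fun j : J => (v j ^+ 2)%:C *:
    adjoint T (orthogonal_proj (W j)
      (adjoint (@Lam j) (Lam j (orthogonal_proj (W j) (U f)))))).

End ControlledGFusionFrames.

Definition resolution_of_identity (R : realType) (H : hilbertType R)
    (I : choiceType) (Rj : I -> H -> H) : Prop :=
  (forall i, bounded_operator (Rj i)) /\
  (forall f, unconditionally_converges_to (fun i => Rj i f) f).

(* Main.v *)
(* Write X_j = v_j^2 T^* P_j Lam_j^* Lam_j P_j U, so that S_C = sum_j X_j and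
   <X_j f, f> is the j-th term of the frame sum.  Polarization makes the finite
   partial sums of <X_j f, g> bounded for all f and g, hence, by uniform
   boundedness, the finite partial sums of X_j f are bounded in norm; in a
   Hilbert space this already forces sum_j X_j f to converge unconditionally,
   since suitably signed sums of n disjoint blocks of norm >= e have norm at
   least e sqrt(n).  The form <S_C f, f> is real with A <= S_C <= B, so S_C is
   symmetric, |S_C f| <= B |f|, and its range is closed with trivial orthogonal
   complement; thus S_C is invertible.  As S_C^-1 commutes with T and U, the
   j-th operator of the resolution is X_j o S_C^-1, and the second sum is the
   frame sum at S_C^-1 f, where |f| / B <= |S_C^-1 f| <= |f| / A. *)
Require Import Defs.
From HB Require Import structures.
From mathcomp Require Import all_boot all_order all_algebra finmap.
From mathcomp Require Import complex.
From mathcomp Require Import all_classical all_reals all_analysis.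
From mathcomp Require Import ring lra.
Import Order.TTheory GRing.Theory Num.Theory.
Import numFieldNormedType.Exports.

Set Implicit Arguments.
Unset Strict Implicit.
Unset Printing Implicit Defensive.

Local Open Scope classical_set_scope.
Local Open Scope ring_scope.
Local Open Scope complex_scope.

(** * Real-valued norms, convergence and completeness *)

(* Norms over R[i] take values in the partially ordered R[i]; [rnorm] is the
   same norm with values in R, where [lra] and [nra] apply. *)
Section RealNorm.
Variables (R : realType) (V : normedModType R[i]).
Implicit Types (x y z : V) (c : R[i]).

Definition rnorm x : R := complex.Re `|x|.

Lemma normE x : `|x| = (rnorm x)%:C.
Proof. by rewrite /rnorm RRe_real. Qed.

Lemma rnorm_ge0 x : 0 <= rnorm x.
Proof. by rewrite -ler0c -normE. Qed.

Lemma ler_rnormD x y : rnorm (x + y) <= rnorm x + rnorm y.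
Proof. by rewrite -lecR rmorphD/= -!normE ler_normD. Qed.

Lemma rnormN x : rnorm (- x) = rnorm x.
Proof. by rewrite /rnorm normrN. Qed.

Lemma ler_rnormB x y : rnorm (x - y) <= rnorm x + rnorm y.
Proof. by rewrite -(rnormN y) ler_rnormD. Qed.

Lemma rnorm_distC x y : rnorm (x - y) = rnorm (y - x).
Proof. by rewrite -rnormN opprB. Qed.

Lemma ler_rnorm_dist y x z : rnorm (x - z) <= rnorm (x - y) + rnorm (y - z).
Proof. by rewrite (le_trans _ (ler_rnormD _ _))// addrA subrK. Qed.

Lemma rnorm0 : rnorm 0 = 0.
Proof. by rewrite /rnorm normr0. Qed.

Lemma rnorm0_eq0 x : rnorm x = 0 -> x = 0.
Proof. by move=> x0; apply/eqP; rewrite -normr_eq0 normE x0. Qed.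

Lemma rnormZ c x : rnorm (c *: x) = complex.Re `|c| * rnorm x.
Proof.
rewrite [LHS]/rnorm normrZ normE; case: `|c| => a b /=.
by rewrite mulr0 subr0.
Qed.

Lemma rnormZr (r : R) x : rnorm (r%:C *: x) = `|r| * rnorm x.
Proof. by rewrite rnormZ normc_def/= expr0n/= addr0 sqrtr_sqr. Qed.

(** A positive element of [R[i]] has zero imaginary part, so real [e] suffice. *)
Lemma cvg_rnormP (I : Type) (F : set_system I) (FF : Filter F) (f : I -> V) x :
  f @ F --> x <-> forall e : R, 0 < e -> F [set i | rnorm (f i - x) < e].
Proof.
rewrite cvgrPdistC_lt; split=> [fx e e0|fx e].
  have : \forall t \near F, `|f t - x| < e%:C by apply: fx; rewrite ltcR.
  by apply: filterS => i /=; rewrite normE ltcR.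
rewrite ltcE => /andP[/eqP/= e1 e0].
have := fx _ e0; apply: filterS => i /=.
by rewrite normE ltcE/= e1 eqxx.
Qed.

Lemma closed_rnormP (A : set V) : closed A <->
  forall x, (forall e : R, 0 < e -> exists2 y, A y & rnorm (y - x) < e) -> A x.
Proof.
split=> [Acl x Ax|Acl x Ax].
  apply: Acl => B /nbhs_ballP[e /= e0 Be].
  have [y Ay xy] : exists2 y, A y & rnorm (y - x) < complex.Re e.
    by apply: Ax; move: e0; rewrite ltcE => /andP[].
  exists y; split => //; apply: Be; rewrite -ball_normE/= distrC normE.
  by move: e0; rewrite !ltcE/= => /andP[/eqP -> _]; rewrite eqxx.
apply: Acl => e e0.
have /Ax[y [Ay]] : nbhs x (ball x e%:C) by apply: nbhsx_ballx; rewrite ltcR.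
by rewrite -ball_normE/= distrC normE ltcR; exists y.
Qed.

End RealNorm.

(** Kept general in [F]: it serves both sequences and the net of finite sets. *)
Lemma complete_rnorm (R : realType) (V : completeNormedModType R[i])
    (I : Type) (F : set_system I) (FF : ProperFilter F) (f : I -> V) :
  (forall e : R, 0 < e -> exists2 S, F S &
     forall i j, S i -> S j -> rnorm (f i - f j) < e) -> cvg (f @ F).
Proof.
move=> fC; apply: cauchy_cvg; apply: cauchy_exP => e.
rewrite ltcE => /andP[/eqP/= e1 e0].
have [S FS Se] := fC _ e0.
have [i Si] := filter_ex FS.
exists (f i); apply: filterS FS => j Sj /=.
by rewrite -ball_normE/= normE ltcE/= e1 eqxx/= Se.
Qed.

(** * Inner products and the Cauchy-Schwarz inequality *)

Section RealInner.
Variables (R : realType) (H : hilbertType R).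
Implicit Types (f g h : H) (c : R[i]) (r : R).

Definition rdot f g : R := complex.Re (inner f g).

Lemma innerDl f g h : inner (f + g) h = inner f h + inner g h.
Proof. exact: linearDl. Qed.

Lemma innerDr f g h : inner h (f + g) = inner h f + inner h g.
Proof. exact: linearDr. Qed.

Lemma innerZl c f h : inner (c *: f) h = c * inner f h.
Proof. exact: linearZl_LR. Qed.

Lemma innerZr c f h : inner h (c *: f) = c^* * inner h f.
Proof. exact: linearZr_LR. Qed.

Lemma innerC f g : inner f g = (inner g f)^*.
Proof. by rewrite /inner hermC expr0 mul1r. Qed.

Lemma inner0l h : inner 0 h = 0.
Proof. exact: linear0l. Qed.

Lemma inner0r h : inner h 0 = 0.
Proof. exact: linear0r. Qed.

Lemma innerBl f g h : inner (f - g) h = inner f h - inner g h.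
Proof. exact: linearBl. Qed.

Lemma inner_suml (I : Type) (s : seq I) (x : I -> H) h :
  inner (\sum_(i <- s) x i) h = \sum_(i <- s) inner (x i) h.
Proof. by elim/big_rec2: _ => [|i y z _ <-]; rewrite ?inner0l ?innerDl. Qed.

(** Conjugate-linearity gives $\langle f, ig\rangle = -i\langle f,g\rangle$, whose real part is the
    imaginary part of $\langle f,g\rangle$; real identities thus yield complex ones. *)
Lemma innerE f g : inner f g = rdot f g +i* rdot f ('i *: g).
Proof. by rewrite /rdot innerZr/=; case: (inner f g) => a b; simpc. Qed.

Lemma rdotDl f g h : rdot (f + g) h = rdot f h + rdot g h.
Proof. by rewrite /rdot innerDl; case: inner; case: inner. Qed.

Lemma rdotC f g : rdot f g = rdot g f.
Proof. by rewrite /rdot innerC; case: inner. Qed.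

Lemma rdotDr f g h : rdot h (f + g) = rdot h f + rdot h g.
Proof. by rewrite rdotC rdotDl !(rdotC h). Qed.

Lemma rdotZl r f h : rdot (r%:C *: f) h = r * rdot f h.
Proof. by rewrite /rdot innerZl; case: inner => a b; simpc. Qed.

Lemma rdotZr r f h : rdot h (r%:C *: f) = r * rdot h f.
Proof. by rewrite rdotC rdotZl rdotC. Qed.

Lemma rdotNl f h : rdot (- f) h = - rdot f h.
Proof. by rewrite -scaleN1r -(rmorphN1 (real_complex R)) rdotZl mulN1r. Qed.

Lemma rdotNr f h : rdot h (- f) = - rdot h f.
Proof. by rewrite rdotC rdotNl rdotC. Qed.

Definition rdotE := (rdotDl, rdotDr, rdotNl, rdotNr, rdotZl, rdotZr).

Lemma inner_norm2 f : inner f f = (rnorm f ^+ 2)%:C.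
Proof. by rewrite /inner innerp_norm normE rmorphXn. Qed.

Lemma rdotff f : rdot f f = rnorm f ^+ 2.
Proof. by rewrite /rdot inner_norm2. Qed.

Lemma rdot_ge0 f : 0 <= rdot f f.
Proof. by rewrite rdotff sqr_ge0. Qed.

Lemma rdot_eq0 f : rdot f f = 0 -> f = 0.
Proof. by rewrite rdotff => /eqP; rewrite sqrf_eq0 => /eqP /rnorm0_eq0. Qed.

Lemma inner_ext f g : (forall h, inner f h = inner g h) -> f = g.
Proof.
move=> fg; apply/eqP; rewrite -subr_eq0; apply/eqP/rdot_eq0.
by rewrite /rdot innerBl fg subrr.
Qed.

(** The squared norm of $|g| f - |f| g$ equals $2|f||g|(|f||g| - \mathrm{Re}\langle f,g\rangle)$. *)
Lemma ler_rdot f g : rdot f g <= rnorm f * rnorm g.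
Proof.
have [g0|g0] := eqVneq (rnorm g) 0.
  by rewrite (rnorm0_eq0 g0) rnorm0 mulr0 /rdot inner0r.
have g1 : 0 < rnorm g by rewrite lt0r g0 rnorm_ge0.
have [f0|f0] := eqVneq (rnorm f) 0.
  by rewrite (rnorm0_eq0 f0) rnorm0 mul0r /rdot inner0l.
have f1 : 0 < rnorm f by rewrite lt0r f0 rnorm_ge0.
have := rdot_ge0 ((rnorm g)%:C *: f - (rnorm f)%:C *: g).
rewrite !rdotE !rdotff (rdotC g f) => h0.
have : 0 <= 2 * (rnorm f * rnorm g) * (rnorm f * rnorm g - rdot f g).
  by apply: le_trans h0 _; rewrite le_eqVlt; apply/orP; left; apply/eqP; ring.
by rewrite pmulr_rge0 ?subr_ge0// !mulr_gt0.
Qed.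

(** Multiplying [f] by the conjugate of [c] makes the inner product the real number $|c|^2$; then
    apply [ler_rdot] and cancel $|c|$. *)
Lemma Re_norm_inner f g : complex.Re `|inner f g| <= rnorm f * rnorm g.
Proof.
set c := inner f g.
have [->|c0] := eqVneq c 0; first by rewrite normr0 mulr_ge0 ?rnorm_ge0.
have cE : `|c| = (complex.Re `|c|)%:C by rewrite RRe_real ?normr_real.
have c1 : 0 < complex.Re `|c| by rewrite -ltcR -cE normr_gt0.
have := ler_rdot ((c^*)%C *: f) g.
rewrite rnormZ normcJ /rdot innerZl -/c mulrC -sqr_normc cE -rmorphXn/=.
by rewrite expr2 -mulrA ler_pM2l.
Qed.

Lemma le_norm_inner f g : `|inner f g| <= (rnorm f * rnorm g)%:C.
Proof. by rewrite -(RRe_real (normr_real (inner f g))) lecR Re_norm_inner. Qed.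

Lemma parallelogram f g :
  rnorm (f + g) ^+ 2 + rnorm (f - g) ^+ 2 = 2 * (rnorm f ^+ 2 + rnorm g ^+ 2).
Proof. by rewrite -!rdotff !rdotE (rdotC g f); ring. Qed.

End RealInner.

(** * Orthogonal projections and the Riesz theorem *)

Section Projection.
Variables (R : realType) (H : hilbertType R).
Implicit Types (f g h w : H) (W : set H).

Lemma subspaceD W f g : closed_subspace W -> W f -> W g -> W (f + g).
Proof. by move=> [_ _ Wl] Wf Wg; rewrite -[f]scale1r; exact: Wl. Qed.

Lemma subspaceZ W (a : R[i]) f : closed_subspace W -> W f -> W (a *: f).
Proof. by move=> [_ W0 Wl] Wf; rewrite -[_ *: _]addr0; exact: Wl. Qed.

(** A minimizing sequence for the distance [d] from [f] to [W] is Cauchy by the parallelogram law;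
    its limit is a nearest point, and minimality forces orthogonality. *)
Lemma exists_orthogonal_proj W f : closed_subspace W ->
  exists p, W p /\ forall w, W w -> inner (f - p) w = 0.
Proof.
move=> sW; have [Wcl W0 _] := sW.
pose D := [set rnorm (f - w) | w in W].
have D_inf : has_inf D.
  split; first by exists (rnorm (f - 0)), 0.
  by exists 0 => _ [w _ <-]; exact: rnorm_ge0.
set d := inf D.
have d_le w : W w -> d <= rnorm (f - w).
  by move=> Ww; apply: ge_inf; [case: D_inf | exists w].
have d_ge0 : 0 <= d.
  by apply: lb_le_inf; [case: D_inf | move=> _ [w _ <-]; exact: rnorm_ge0].
have /choice[w_ w_P] (n : nat) :
    exists w, W w /\ rnorm (f - w) < d + n.+1%:R^-1.
  have n0 : 0 < n.+1%:R^-1 :> R by rewrite invr_gt0.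
  by have [_ [w Ww <-] wd] := inf_adherent n0 D_inf; exists w.
have near_w (e : R) : 0 < e -> exists N : nat, forall n, (N <= n)%N ->
    rnorm (f - w_ n) < d + e.
  move=> e0; have [N _ NP] := near_infty_natSinv_lt (PosNum e0).
  exists N => n Nn; have [_ wn] := w_P n.
  by apply: (lt_le_trans wn); rewrite lerD2l ltW//; exact: NP.
have w_cvg : cvg (w_ n @[n --> \oo]).
  apply: complete_rnorm => e e0.
  (* If two terms are within [d + t] of [f], their squared distance is at most $4(d+t)^2 - 4d^2 \le
     4t(2d+1)$, using $t \le 1$; this is below $e^2$. *)
  pose t := Num.min 1 (e ^+ 2 / (8 * (2 * d + 1))).
  have t0 : 0 < t by rewrite lt_min ltr01 divr_gt0 ?exprn_gt0//; nra.
  have t1 : t <= 1 by rewrite ge_min lexx.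
  have t2 : t * (8 * (2 * d + 1)) <= e ^+ 2.
    by rewrite -ler_pdivlMr ?ge_min ?lexx ?orbT//; nra.
  have [N NP] := near_w _ t0.
  exists [set n | (N <= n)%N]; first by exists N.
  move=> i j /NP di /NP dj.
  have [[Wi _] [Wj _]] := (w_P i, w_P j).
  have := parallelogram (f - w_ i) (f - w_ j).
  have -> : f - w_ i - (f - w_ j) = w_ j - w_ i.
    by rewrite opprB addrC addrA subrK.
  (* The midpoint of the two terms lies in [W], so its distance to [f] is at least [d]. *)
  have -> : f - w_ i + (f - w_ j) = 2%:C *: (f - (2^-1)%:C *: (w_ i + w_ j)).
    rewrite scalerBr scalerA -rmorphM/= divff ?pnatr_eq0//.
    by rewrite rmorph_nat scale1r scaler_nat mulr2n opprD addrACA.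
  have := d_le _ (subspaceZ (2^-1)%:C sW (subspaceD sW Wi Wj)).
  set m := rnorm (f - _); rewrite rnormZr normr_nat => dm.
  have := rnorm_ge0 (f - w_ i); have := rnorm_ge0 (f - w_ j).
  rewrite (rnorm_distC (w_ i)); have := rnorm_ge0 (w_ j - w_ i).
  move: di dj; set x := rnorm (f - w_ i); set y := rnorm (f - w_ j).
  set z := rnorm _ => xd yd z0 y0 x0 xyz.
  have x2 : x ^+ 2 <= (d + t) ^+ 2 by rewrite ler_pXn2r ?nnegrE//; lra.
  have y2 : y ^+ 2 <= (d + t) ^+ 2 by rewrite ler_pXn2r ?nnegrE//; lra.
  have m2 : d ^+ 2 <= m ^+ 2 by rewrite ler_pXn2r ?nnegrE//; lra.
  rewrite -(@ltr_pXn2r _ 2)// ?nnegrE ?(ltW e0)//.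
  have td : t * (4 * (2 * d + 1)) < t * (8 * (2 * d + 1)).
    by rewrite ltr_pM2l//; lra.
  have tt : t * t <= t by rewrite ger_pMl.
  by nra.
have [p /cvg_rnormP wp] := (cvg_ex _).1 w_cvg.
have Wp : W p.
  apply: ((closed_rnormP _).1 Wcl) => e /wp/filter_ex[n np].
  by exists (w_ n) => //; case: (w_P n).
have pd : rnorm (f - p) <= d.
  apply/ler_addgt0Pr => e e0; have e20 : 0 < e / 2 by lra.
  have [N NP] := near_w _ e20; have [M _ MP] := wp _ e20.
  have := NP _ (leq_maxl N M); have := MP _ (leq_maxr N M) => /=.
  by have := ler_rnorm_dist (w_ (maxn N M)) f p; lra.
have ort w : W w -> rdot (f - p) w = 0.
  (* Moving [p] by [u *: w] lowers the squared distance by $u^2(|w|^2+2)$, so $u = 0$. The added 1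
     keeps the denominator positive when $w = 0$. *)
  move=> Ww; pose u := rdot (f - p) w / (rdot w w + 1).
  have s0 := rdot_ge0 w.
  have uE : rdot (f - p) w = u * (rdot w w + 1) by rewrite divfK//; lra.
  have Wq : W (p + u%:C *: w) by apply: subspaceD => //; exact: subspaceZ.
  have : rnorm (f - p) ^+ 2 <= rnorm (f - (p + u%:C *: w)) ^+ 2.
    by rewrite ler_pXn2r ?nnegrE ?rnorm_ge0// (le_trans pd)// d_le.
  rewrite opprD addrA -!rdotff; move: (f - p) uE => q uE.
  rewrite !rdotE (rdotC w q) uE => h.
  have {h} : u ^+ 2 * (rdot w w + 2) <= 0 by lra.
  rewrite pmulr_lle0 ?ltr_wpDl// => u2.
  by have /eqP : u ^+ 2 = 0 by [apply/eqP; rewrite eq_le u2 sqr_ge0];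
    rewrite sqrf_eq0 => /eqP ->; rewrite mul0r.
exists p; split => // w Ww.
by rewrite innerE !ort//; exact: subspaceZ.
Qed.

Section ProjectionTheory.
Variables (W : set H) (sW : closed_subspace W).
Local Notation P := (orthogonal_proj W).

Lemma orthogonal_projP f : W (P f) /\ forall w, W w -> inner (f - P f) w = 0.
Proof.
exact: (@xgetPex _ 0 [set p | W p /\ forall w, W w -> inner (f - p) w = 0]
         (exists_orthogonal_proj f sW)).
Qed.

(** [P f - p] lies in [W] and is a difference of two vectors orthogonal to [W], hence is orthogonal
    to itself. *)
Lemma orthogonal_proj_unique f p :
  W p -> (forall w, W w -> inner (f - p) w = 0) -> P f = p.
Proof.
move=> Wp pf; have [WP Pf] := orthogonal_projP f.
apply/eqP; rewrite -subr_eq0; apply/eqP/rdot_eq0.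
have Wd : W (P f - p).
  by rewrite -scaleN1r; apply: subspaceD => //; exact: subspaceZ.
have dE : P f - p = (f - p) - (f - P f) by rewrite opprB [RHS]addrC addrA subrK.
by rewrite /rdot {1}dE innerBl pf// Pf// subr0.
Qed.

(** Both sides equal [inner (P f) (P g)]. *)
Lemma orthogonal_proj_selfadjoint f g : inner (P f) g = inner f (P g).
Proof.
have [Wf fP] := orthogonal_projP f; have [Wg gP] := orthogonal_projP g.
have /eqP := fP _ Wg; rewrite innerBl subr_eq0 => /eqP ->.
rewrite innerC [RHS]innerC; congr conjc.
by have /eqP := gP _ Wf; rewrite innerBl subr_eq0 => /eqP ->.
Qed.

(** Linearity comes from uniqueness, the bound 1 from $|Pf|^2 = \mathrm{Re}\langle f,Pf\rangle \le
    |f||Pf|$. *)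
Lemma bounded_orthogonal_proj : bounded_operator P.
Proof.
split.
  move=> a f g; have [Wf fP] := orthogonal_projP f.
  have [Wg gP] := orthogonal_projP g.
  apply: orthogonal_proj_unique.
    by apply: subspaceD => //; exact: subspaceZ.
  move=> w Ww; rewrite opprD addrACA -scalerBr innerDl innerZl.
  by rewrite fP// gP// mulr0 addr0.
exists 1 => f; rewrite mul1r !normE lecR.
have [Wf fP] := orthogonal_projP f.
have : rdot (P f) (P f) = rdot f (P f).
  have /eqP := fP _ Wf; rewrite innerBl subr_eq0 => /eqP fPE.
  by rewrite /rdot fPE.
have := ler_rdot f (P f); have := rnorm_ge0 (P f).
rewrite rdotff le_eqVlt => /predU1P[<- _ _|P0]; first exact: rnorm_ge0.
by move=> + E; rewrite -E expr2 ler_pM2r.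
Qed.

End ProjectionTheory.

(** If [phi] is nonzero, take [u] orthogonal to its closed kernel with [phi u] nonzero: $f -
    (\phi(f)/\phi(u))u$ is in the kernel, and pairing it with [u] gives the formula. *)
Lemma riesz (phi : H -> R[i]) (M : R) :
  (forall a f g, phi (a *: f + g) = a * phi f + phi g) ->
  (forall f, `|phi f| <= (M * rnorm f)%:C) ->
  exists h, forall f, phi f = inner f h.
Proof.
move=> phiL phiM.
have phi0 : phi 0 = 0.
  by apply/eqP; rewrite -normr_le0 (le_trans (phiM _))// rnorm0 mulr0.
have phiD f g : phi (f + g) = phi f + phi g.
  by have := phiL 1 f g; rewrite scale1r mul1r.
have phiZ a f : phi (a *: f) = a * phi f.
  by rewrite -[_ *: _]addr0 phiL phi0 addr0.
pose K := [set f | phi f = 0].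
have sK : closed_subspace K.
  split => [||a f g Kf Kg]; [|exact: phi0|]; last first.
    by rewrite /K/= phiL Kf Kg mulr0 addr0.
  apply/closed_rnormP => f fK.
  suff : complex.Re `|phi f| <= 0.
    by rewrite -lecR RRe_real ?normr_real// normr_le0 => /eqP.
  apply/ler_addgt0Pr => e e0; rewrite add0r.
  (* The sign of [M] is unknown, hence the positive majorant $|M|+1$. *)
  have M1 : 0 < `|M| + 1 by rewrite ltr_wpDl.
  have [g Kg gf] := fK (e / (`|M| + 1)) (divr_gt0 e0 M1).
  rewrite -lecR RRe_real ?normr_real//.
  have -> : phi f = phi (f - g).
    by rewrite phiD -scaleN1r phiZ Kg mulr0 addr0.
  apply: (le_trans (phiM _)); rewrite lecR rnorm_distC.
  move: gf; rewrite ltr_pdivlMr// => gf.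
  by have := rnorm_ge0 (g - f); have := ler_norm M; nra.
have [[z z0]|] := pselect (exists z, phi z != 0); last first.
  move=> h; exists 0 => f; rewrite inner0r.
  by apply: contra_notP h => /eqP; exists f.
have [Kp pz] := orthogonal_projP sK z.
set u := z - orthogonal_proj K z in pz.
have phiu : phi u = phi z.
  by rewrite phiD -scaleN1r phiZ Kp mulr0 addr0.
have u0 : phi u != 0 by rewrite phiu.
have uu : inner u u != 0.
  rewrite inner_norm2 -(rmorph0 (real_complex R)) (inj_eq (@complexI _)).
  rewrite sqrf_eq0; apply: contraNneq u0 => /rnorm0_eq0 ->.
  by rewrite phi0.
exists ((phi u / inner u u)^* *: u) => f.
have Kf : K (f - (phi f / phi u) *: u).
  by rewrite /K/= phiD -scaleN1r !phiZ divfK// mulN1r subrr.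
have /eqP := pz _ Kf.
rewrite innerC conjc_eq0 innerBl innerZl subr_eq0 => /eqP fE.
rewrite innerZr conjCK fE; move: u0 uu.
by move: (phi u) (inner u u) => c d c0 d0; field; rewrite c0.
Qed.

End Projection.

(** * Bounded operators and adjoints *)

Section BoundedOperators.
Variables (R : realType).

Section Basics.
Variables (H K : hilbertType R) (T : H -> K).

Lemma bounded_operatorP : bounded_operator T <->
  linear T /\ exists2 M, 0 <= M & forall f, rnorm (T f) <= M * rnorm f.
Proof.
split=> [[TL [M MT]]|[TL [M M0 MT]]]; split=> //; last first.
  by exists M => f; rewrite !normE -rmorphM lecR.
exists `|M| => // f; have := MT f.
rewrite !normE -rmorphM lecR => /le_trans; apply.
by rewrite ler_wpM2r ?rnorm_ge0// ler_norm.
Qed.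

Hypothesis TL : linear T.

Lemma linear_opD f g : T (f + g) = T f + T g.
Proof. by rewrite -[f]scale1r TL !scale1r. Qed.

Lemma linear_op0 : T 0 = 0.
Proof. by have := TL (-1) 0 0; rewrite !scaleN1r oppr0 addr0 addNr. Qed.

Lemma linear_opZ (a : R[i]) f : T (a *: f) = a *: T f.
Proof. by rewrite -[_ *: f]addr0 TL linear_op0 addr0. Qed.

Lemma linear_opB f g : T (f - g) = T f - T g.
Proof. by rewrite linear_opD -[- g]scaleN1r linear_opZ scaleN1r. Qed.

End Basics.

Lemma bounded_comp (H K L : hilbertType R) (S : K -> L) (T : H -> K) :
  bounded_operator S -> bounded_operator T -> bounded_operator (S \o T).
Proof.
move=> /bounded_operatorP[SL [M M0 SM]] /bounded_operatorP[TL [N N0 TN]].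
apply/bounded_operatorP; split; first by move=> a f g /=; rewrite TL SL.
exists (M * N) => [|f]; first exact: mulr_ge0.
by rewrite (le_trans (SM _))// -mulrA ler_wpM2l.
Qed.

Lemma bounded_scale (H K : hilbertType R) (a : R[i]) (T : H -> K) :
  bounded_operator T -> bounded_operator (fun f => a *: T f).
Proof.
move=> /bounded_operatorP[TL [M M0 TM]]; apply/bounded_operatorP; split.
  by move=> b f g; rewrite TL scalerDr !scalerA mulrC.
exists (complex.Re `|a| * M) => [|f].
  by rewrite mulr_ge0// -ler0c RRe_real ?normr_real.
rewrite rnormZ -mulrA ler_wpM2l//.
by rewrite -ler0c RRe_real ?normr_real.
Qed.

Section Adjoint.
Variables (H K : hilbertType R) (T : H -> K) (Tb : bounded_operator T).

(** Riesz for [fun f => inner (T f) g] shows that [xget] does not fall back to its default. *)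
Lemma adjointP f g : inner (T f) g = inner f (adjoint T g).
Proof.
have /bounded_operatorP[TL [M M0 TM]] := Tb.
have [||h hP] := @riesz _ H (fun f => inner (T f) g) (M * rnorm g).
- by move=> a x y; rewrite TL innerDl innerZl.
- move=> x; rewrite (le_trans (le_norm_inner _ _))// lecR mulrAC.
  by rewrite ler_wpM2r ?rnorm_ge0.
- exact: (@xgetPex _ 0 [set h | forall f, inner (T f) g = inner f h]
           (ex_intro _ h hP)).
Qed.

Lemma adjointPl f g : inner (adjoint T g) f = inner g (T f).
Proof. by rewrite innerC -adjointP -innerC. Qed.

(** With $g = T^*f$, $|g|^2 = \mathrm{Re}\langle Tg,f\rangle \le M|g||f|$. *)
Lemma bounded_adjoint : bounded_operator (adjoint T).
Proof.
have /bounded_operatorP[TL [M M0 TM]] := Tb.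
apply/bounded_operatorP; split.
  move=> a f g; apply: inner_ext => h.
  rewrite innerC -adjointP !(innerDr, innerZr) !adjointP [RHS]innerC.
  by rewrite !(innerDr, innerZr).
exists M => // f; set g := adjoint T f.
have [->|g0] := eqVneq (rnorm g) 0; first by rewrite mulr_ge0 ?rnorm_ge0.
have g1 : 0 < rnorm g by rewrite lt0r g0 rnorm_ge0.
have := rdotff g; rewrite /rdot -adjointP -/(rdot _ _) => E.
have := ler_rdot (T g) f; rewrite E expr2 => gg.
rewrite -(ler_pM2r g1) (le_trans gg)//.
by rewrite mulrAC ler_wpM2r ?rnorm_ge0.
Qed.

End Adjoint.

End BoundedOperators.

(** * The uniform boundedness principle *)

Section UniformBoundedness.
Variables (R : realType) (H : hilbertType R).

Lemma exists_natSinv_lt (e : R) : 0 < e ->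
  exists N : nat, forall n, (N <= n)%N -> n.+1%:R^-1 < e.
Proof.
move=> e0; have [N _ NP] := near_infty_natSinv_lt (PosNum e0).
by exists N => n Nn; exact: NP.
Qed.

Lemma expn3_ge (n : nat) : n.+1%:R <= 3 ^+ n :> R.
Proof.
elim: n => [|n ih]; first by rewrite expr0.
have n1 : 1 <= n.+1%:R :> R by rewrite ler1n.
by rewrite exprS -natr1; lra.
Qed.

(* Gliding hump after Sokal: moving [x] by [+/- e *: y / |y|] one of the two
   choices makes [|rdot y _|] at least [e * |y|], because
   [max |a + b| |a - b| >= |b|]. *)
Lemma hump (x y : H) (e : R) : 0 <= e ->
  exists x', rnorm (x' - x) <= e /\ e * rnorm y <= `|rdot y x'|.
Proof.
move=> e0; have [y0|y0] := eqVneq (rnorm y) 0.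
  by exists x; rewrite y0 subrr rnorm0 mulr0.
have y1 : 0 < rnorm y by rewrite lt0r y0 rnorm_ge0.
pose z := (e / rnorm y)%:C *: y.
have zn : rnorm z = e.
  by rewrite rnormZr ger0_norm ?divr_ge0 ?rnorm_ge0// divfK.
have yz : rdot y z = e * rnorm y.
  by rewrite rdotZr rdotff expr2 mulrA divfK.
have [h|h] := lerP 0 (rdot y x).
  exists (x + z); rewrite addrC addKr zn rdotDr yz; split => //.
  by rewrite ger0_norm ?addr_ge0 ?mulr_ge0 ?rnorm_ge0// lerDr.
exists (x - z); rewrite addrC addKr rnormN zn rdotDr rdotNr yz; split => //.
have ey : 0 <= e * rnorm y by rewrite mulr_ge0 ?rnorm_ge0.
by rewrite ltr0_norm; lra.
Qed.

(** Otherwise pick [y_ n] of norm above $n3^n$ and take humps of size $3^{-n}$. The limit [x] is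
    within $3^{-n}/2$ of [x_ n.+1], so at most half of each hump is lost and $|\mathrm{Re}\langle
    y_n,x\rangle| \ge n/2$ for every [n]. *)
Lemma uniform_boundedness (Y : set H) :
  (forall g, exists M, forall y, Y y -> `|rdot y g| <= M) ->
  exists M, forall y, Y y -> rnorm y <= M.
Proof.
move=> Yg; apply: contrapT => Yub.
have /choice[y_ y_P] (n : nat) : exists y, Y y /\ n%:R * 3 ^+ n < rnorm y.
  apply: contra_notP Yub => nY; exists (n%:R * 3 ^+ n) => y Yy.
  by rewrite leNgt; apply/negP => h; apply: nY; exists y.
have t0 (n : nat) : 0 < (3 ^- n : R) by rewrite invr_gt0 exprn_gt0.
have /choice[step stepP] (p : nat * H) : exists x',
    rnorm (x' - p.2) <= 3 ^- p.1 /\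
    3 ^- p.1 * rnorm (y_ p.1) <= `|rdot (y_ p.1) x'|.
  by apply: hump; exact: ltW.
pose fix x_ n := if n is m.+1 then step (m, x_ m) else 0.
have x_S n : rnorm (x_ n.+1 - x_ n) <= 3 ^- n by case: (stepP (n, x_ n)).
have y_x n : 3 ^- n * rnorm (y_ n) <= `|rdot (y_ n) (x_ n.+1)|.
  by case: (stepP (n, x_ n)).
(* The extra summand is the geometric tail still to come; with it the induction closes. *)
have x_tail n k :
    rnorm (x_ (n + k)%N - x_ n) + 3 / 2 * 3 ^- (n + k) <= 3 / 2 * 3 ^- n.
  elim: k => [|k ih]; first by rewrite addn0 subrr rnorm0 add0r.
  apply: le_trans ih; rewrite addnS exprS invfM.
  have := ler_rnorm_dist (x_ (n + k)%N) (x_ (n + k).+1) (x_ n).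
  by have := x_S (n + k)%N; lra.
have x_dist n m : (n <= m)%N -> rnorm (x_ m - x_ n) <= 3 / 2 * 3 ^- n.
  move=> /subnKC <-; have := x_tail n (m - n)%N.
  by have := t0 (n + (m - n))%N; lra.
have /cvg_ex[x /cvg_rnormP xP] : cvg (x_ n @[n --> \oo]).
  apply: complete_rnorm => e e0.
  have e30 : 0 < e / 3 by lra.
  have [N NP] := exists_natSinv_lt e30.
  exists [set n | (N <= n)%N]; first by exists N.
  move=> i j /x_dist iN /x_dist; rewrite rnorm_distC => jN.
  have tN : 3 ^- N <= N.+1%:R^-1 :> R.
    by rewrite lef_pV2 ?posrE ?exprn_gt0// expn3_ge.
  have {}tN := le_lt_trans tN (NP _ (leqnn N)).
  by have := ler_rnorm_dist (x_ N) (x_ i) (x_ j); lra.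
have xx n : rnorm (x_ n.+1 - x) <= 3 ^- n / 2.
  apply/ler_addgt0Pr => e /xP[N _ NP].
  have : rnorm (x_ (maxn N n.+1) - x) < e := NP _ (leq_maxl N n.+1).
  have := x_dist _ _ (leq_maxr N n.+1); rewrite rnorm_distC exprS invfM.
  by have := ler_rnorm_dist (x_ (maxn N n.+1)) (x_ n.+1) x; lra.
have [M YM] := Yg x.
have big n : n%:R / 2 <= M.
  have [Yy yn] := y_P n; apply: le_trans (YM _ Yy).
  have := y_x n; have -> : x_ n.+1 = x + (x_ n.+1 - x) by rewrite addrC subrK.
  have d1 : `|rdot (y_ n) (x_ n.+1 - x)| <= rnorm (y_ n) * (3 ^- n / 2).
    apply: (@le_trans _ _ (rnorm (y_ n) * rnorm (x_ n.+1 - x))); last first.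
      by rewrite ler_wpM2l ?rnorm_ge0.
    by rewrite ler_norml ler_rdot andbT lerNl -rdotNl -(rnormN (y_ n)) ler_rdot.
  have d2 : n%:R <= 3 ^- n * rnorm (y_ n).
    by rewrite mulrC ler_pdivlMr ?exprn_gt0// ltW.
  rewrite rdotDr => /le_trans/(_ (ler_normD _ _)); lra.
have := big (Num.truncn (2 * M)).+1.
by have := truncnS_gt (2 * M); lra.
Qed.

End UniformBoundedness.

(** * Unconditional convergence and bounded partial sums *)

Section UnconditionalConvergence.
Local Open Scope fset_scope.
Local Open Scope ring_scope.

Lemma big_fsetU_disjoint (V : nmodType) (I : choiceType) (x : I -> V)
    (A B : {fset I}) : [disjoint A & B] ->
  \sum_(i <- A `|` B) x i = \sum_(i <- A) x i + \sum_(i <- B) x i.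
Proof.
move=> /fdisjointP AB; rewrite (big_fsetID _ (mem A)); congr (_ + _).
  congr (\sum_(i <- enum_fset _) _); apply/fsetP => i; rewrite !inE/=.
  by case: (i \in A); case: (i \in B).
congr (\sum_(i <- enum_fset _) _); apply/fsetP => i; rewrite !inE/=.
by case: (boolP (i \in A)) => [/AB/negbTE ->|_]//=; rewrite andbT.
Qed.

Lemma big_fsetD_sub (V : nmodType) (I : choiceType) (x : I -> V)
    (A B : {fset I}) : A `<=` B ->
  \sum_(i <- B) x i = \sum_(i <- A) x i + \sum_(i <- B `\` A) x i.
Proof.
move=> AB; rewrite -big_fsetU_disjoint.
  2: by apply/fdisjointP => i iA; rewrite inE iA.
congr (\sum_(i <- enum_fset _) _); apply/fsetP => i; rewrite !inE.
by case: (boolP (i \in A)) => //= /(fsubsetP AB).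
Qed.

Variables (R : realType) (I : choiceType).

Lemma ler_rnorm_sum (V : normedModType R[i]) (s : seq I) (x : I -> V) :
  rnorm (\sum_(i <- s) x i) <= \sum_(i <- s) rnorm (x i).
Proof.
elim/big_rec2: _ => [|i y z _ ih]; first by rewrite rnorm0.
by rewrite (le_trans (ler_rnormD _ _))// lerD2l.
Qed.

(** Sums over sets containing [A0] are within 1 of [s]; passing from [A] to its union with [A0] adds
    only terms indexed by [A0]. *)
Lemma unconditional_bounded (V : normedModType R[i]) (x : I -> V) :
  unconditionally_converges x ->
  exists M, forall A, rnorm (partial_sum x A) <= M.
Proof.
move=> /cvg_ex[s /cvg_rnormP/(_ 1 ltr01)[A0 A0P]].
exists (1 + rnorm s + \sum_(i <- A0) rnorm (x i)) => A.
have := A0P _ (fsubsetUl A0 A).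
have AE : A0 `|` A = A `|` (A0 `\` A).
  by apply/fsetP => i; rewrite !inE; case: (_ \in A); case: (_ \in A0).
have E : partial_sum x (A0 `|` A) =
    partial_sum x A + partial_sum x (A0 `\` A).
  rewrite AE [LHS]big_fsetU_disjoint//.
  by apply/fdisjointP => i iA; rewrite inE iA.
have : rnorm (partial_sum x (A0 `\` A)) <= \sum_(i <- A0) rnorm (x i).
  rewrite (le_trans (ler_rnorm_sum _ _))//.
  rewrite (@big_fsetD_sub _ _ _ (A0 `\` A) A0) ?fsubsetDl// lerDl.
  by apply: sumr_ge0 => i _; exact: rnorm_ge0.
rewrite /= E; set u := partial_sum x A; set v := partial_sum x _ => vM us.
have -> : u = (u + v - s) + s - v by rewrite subrK addrK.
have := ler_rnormB (u + v - s + s) v; have := ler_rnormD (u + v - s) s; lra.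
Qed.

(* If the net is not Cauchy, adjoining to one of two disjoint sets [P], [Q] a
   block of norm [>= e], with the sign of the cross term chosen favourably,
   makes [|sum_P - sum_Q|^2] grow by [e^2] at each step. *)
Lemma bounded_unconditional (H : hilbertType R) (x : I -> H) (M : R) :
  (forall A, rnorm (partial_sum x A) <= M) -> unconditionally_converges x.
Proof.
move=> xM; apply: complete_rnorm => e e0; apply: contrapT => nS.
(* If all blocks disjoint from [A] were below [e / 2], comparison with the sum over [A] would put
   any two larger sums within [e]. *)
have block (A : {fset I}) :
    exists2 B : {fset I}, [disjoint A & B] & e / 2 <= rnorm (partial_sum x B).
  apply: contra_notP nS => nB.
  have nB' (B : {fset I}) : A `<=` B ->
      rnorm (partial_sum x B - partial_sum x A) < e / 2.
    move=> AB; rewrite {1}/partial_sum (big_fsetD_sub _ AB) addrC addKr ltNge.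
    apply/negP => h; apply: nB; exists (B `\` A) => //.
    by apply/fdisjointP => i iA; rewrite inE iA.
  exists (fun B => is_true (A `<=` B)); first by exists A.
  move=> B C /nB' BA /nB'; rewrite rnorm_distC => CA.
  have := ler_rnorm_dist (partial_sum x A) (partial_sum x B) (partial_sum x C).
  by lra.
have grow (n : nat) : exists P Q : {fset I},
    n%:R * (e / 2) ^+ 2 <= rnorm (partial_sum x P - partial_sum x Q) ^+ 2.
  elim: n => [|n [P [Q PQ]]].
    by exists fset0, fset0; rewrite mul0r sqr_ge0.
  have [B] := block (P `|` Q); rewrite fdisjointUX => /andP[PB QB] eB.
  have eB2 : (e / 2) ^+ 2 <= rnorm (partial_sum x B) ^+ 2.
    by rewrite ler_pXn2r ?nnegrE ?rnorm_ge0//; lra.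
  have [h|h] := lerP 0 (rdot (partial_sum x P - partial_sum x Q)
                             (partial_sum x B)).
    exists (P `|` B), Q; rewrite /partial_sum big_fsetU_disjoint// addrAC.
    move: PQ eB2 h; rewrite /partial_sum.
    move: (\sum_(i <- P) x i - \sum_(i <- Q) x i) (\sum_(i <- B) x i) => u v.
    by rewrite -!rdotff !rdotE (rdotC v u) -natr1 => *; lra.
  exists P, (Q `|` B); rewrite /partial_sum big_fsetU_disjoint// opprD addrA.
  move: PQ eB2 h; rewrite /partial_sum.
    move: (\sum_(i <- P) x i - \sum_(i <- Q) x i) (\sum_(i <- B) x i) => u v.
  by rewrite -!rdotff !rdotE (rdotC v u) -natr1 => *; lra.
have e2 : 0 < (e / 2) ^+ 2 by rewrite exprn_gt0//; lra.
(* Differences of partial sums have norm at most [2 * M], which this [n] makes [grow] exceed. *)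
pose n := (Num.truncn ((2 * M) ^+ 2 / (e / 2) ^+ 2)).+1.
have [P [Q PQ]] := grow n.
have : (2 * M) ^+ 2 < n%:R * (e / 2) ^+ 2 by rewrite -ltr_pdivrMr// truncnS_gt.
apply/negP; rewrite -leNgt (le_trans PQ)//.
have := xM P; have := xM Q.
have := ler_rnormB (partial_sum x P) (partial_sum x Q).
have := rnorm_ge0 (partial_sum x P - partial_sum x Q).
by move=> h1 h2 h3 h4; rewrite ler_pXn2r ?nnegrE//; lra.
Qed.

End UnconditionalConvergence.

(** * Polarization and symmetry *)

Section Polarization.
Variables (R : realType) (H : hilbertType R) (Y : H -> H) (YL : linear Y).

Let p f := inner (Y f) f.

Lemma polarization f g : 4 * inner (Y f) g =
  p (f + g) - p (f - g) + 'i * (p (f + 'i *: g) - p (f - 'i *: g)).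
Proof.
rewrite /p -!scaleNr -[- g]scaleN1r.
rewrite !(linear_opD YL, linear_opZ YL, innerDl, innerDr, innerZl, innerZr)/=.
rewrite -[4]/(4%:R).
case: (inner (Y f) f) => a1 a2; case: (inner (Y f) g) => b1 b2.
case: (inner (Y g) f) => c1 c2; case: (inner (Y g) g) => d1 d2.
rewrite -!(rmorph_nat (real_complex R)) -(rmorphN1 (real_complex R)).
apply/eqP; rewrite eq_complex /=; apply/andP; split; apply/eqP; ring.
Qed.

(** For real [p] the real part of polarization is $p(f+g)-p(f-g)$, which is unchanged when [f] and
    [g] are exchanged. *)
Lemma rdot_sym_of_real_form : (forall f, complex.Im (p f) = 0) ->
  forall f g, rdot (Y f) g = rdot f (Y g).
Proof.
move=> pR.
have E f g : 4 * rdot (Y f) g = complex.Re (p (f + g)) - complex.Re (p (f - g)).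
  have := congr1 (@complex.Re R) (polarization f g).
  have := pR (f + 'i *: g); have := pR (f - 'i *: g).
  rewrite /rdot -!(rmorph_nat (real_complex R)).
  case: (inner (Y f) g) (p (f + g)) (p (f - g)) => b1 b2 [c1 c2] [d1 d2].
  case: (p (f + 'i *: g)) (p (f - 'i *: g)) => e1 e2 [h1 h2] /= -> ->.
  by move=> E; lra.
move=> f g; rewrite [RHS]rdotC.
have : 4 * rdot (Y f) g = 4 * rdot (Y g) f.
  rewrite !E [g + f]addrC -(opprB f g) /p -[- (f - g)]scaleN1r.
  rewrite (linear_opZ YL) innerZl innerZr rmorphN1 mulrA mulrNN.
  by rewrite !mul1r.
by move=> e; lra.
Qed.

End Polarization.

Lemma cvg_unique_normed (R : realType) (V : normedModType R[i]) (J : Type)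
    (G : set_system J) (GG : ProperFilter G) (u : J -> V) (x y : V) :
  u @ G --> x -> u @ G --> y -> x = y.
Proof. by move=> ux uy; exact: (cvg_unique (@norm_hausdorff _ V) ux uy). Qed.

Lemma cvg_inner (R : realType) (H : hilbertType R) (J : Type)
    (G : set_system J) (GG : Filter G) (u : J -> H) s g :
  u @ G --> s -> (fun i => inner (u i) g : R[i]^o) @ G --> (inner s g : R[i]^o).
Proof.
move=> /cvg_rnormP us; apply/cvg_rnormP => e e0.
have g1 : 0 < rnorm g + 1 by rewrite ltr_wpDl ?rnorm_ge0.
have := us _ (divr_gt0 e0 g1); apply: filterS => i /=.
rewrite ltr_pdivlMr// => h; rewrite -innerBl.
have := Re_norm_inner (u i - s) g; have := rnorm_ge0 (u i - s).
by rewrite /rnorm /=; rewrite -/(rnorm _) -/(rnorm _); nra.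
Qed.

(** * Operator series with a coercive quadratic form *)

Section CoerciveSeries.
Variables (R : realType) (H : hilbertType R) (I : choiceType).
Variables (X : I -> H -> H) (A B : R).
Hypothesis XL : forall i, linear (X i).
Let form f : I -> R[i]^o := fun i => inner (X i f) f.
Hypothesis form_cvg : forall f, unconditionally_converges (form f).
Hypothesis A0 : 0 < A.
Hypothesis AB : A <= B.
Hypothesis form_ge : forall f, A%:C * `|f| ^+ 2 <= usum (form f).
Hypothesis form_le : forall f, usum (form f) <= B%:C * `|f| ^+ 2.

(** For the summands [X] of the final theorem this is convertible to [frame_operator]. *)
Let S f := usum (X ^~ f).

Lemma partial_sum_linear (F : {fset I}) :
  linear (fun f => partial_sum (X ^~ f) F).
Proof.
move=> a f g; rewrite /partial_sum scaler_sumr -big_split/=.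
by apply: eq_bigr => i _; rewrite XL.
Qed.

Lemma series_unconditional f : unconditionally_converges (X ^~ f).
Proof.
have [|M YM] := @uniform_boundedness R H
    (range (fun F : {fset I} => partial_sum (X ^~ f) F)); last first.
  by apply: (@bounded_unconditional R I H _ M) => F; apply: YM; exists F.
move=> g.
have [M1 h1] := unconditional_bounded (@form_cvg (f + g)).
have [M2 h2] := unconditional_bounded (@form_cvg (f - g)).
have [M3 h3] := unconditional_bounded (@form_cvg (f + 'i *: g)).
have [M4 h4] := unconditional_bounded (@form_cvg (f - 'i *: g)).
(* One bound for each of the four terms of [polarization], applied to the finite partial sum
   operator; 4 is its left-hand factor. *)
exists ((M1 + M2 + M3 + M4) / 4) => _ [F _ <-].
have pE h : inner (partial_sum (X ^~ h) F) h = partial_sum (form h) F.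
  by rewrite inner_suml.
have := polarization (partial_sum_linear F) f g; rewrite !pE.
move: (h1 F) (h2 F) (h3 F) (h4 F).
move: (partial_sum (form _) F) (partial_sum (form _) F).
move: (partial_sum (form _) F) (partial_sum (form _) F) => z3 z4 z1 z2.
move=> z1M z2M z3M z4M.
rewrite /rdot; move: (inner _ g) => w E.
rewrite ler_pdivlMr//.
have iE (z : R[i]^o) : rnorm ('i * z : R[i]^o) = rnorm z.
  rewrite /rnorm normrM (_ : `|'i| = 1) ?mul1r//.
  by rewrite normc_def/= expr0n/= add0r expr1n sqrtr1.
have : rnorm (4 * w : R[i]^o) <= M1 + M2 + (M3 + M4).
  rewrite E (le_trans (ler_rnormD _ _))// lerD//.
    by rewrite (le_trans (ler_rnormB _ _))// lerD.
  by rewrite iE (le_trans (ler_rnormB _ _))// lerD.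
have -> : rnorm (4 * w : R[i]^o) = complex.Re `|w| * 4.
  rewrite /rnorm normrM normr_nat -(rmorph_nat (real_complex R)).
  by case: `|w| => a b; rewrite /= mul0r subr0 mulrC.
rewrite addrA; apply: le_trans; rewrite ler_pM2r//.
by rewrite -lecR RRe_real ?normr_real// normc_ge_Re.
Qed.

Lemma cvg_series f : partial_sum (X ^~ f) F @[F --> @finite_sets I] --> S f.
Proof. exact: series_unconditional. Qed.

Lemma series_linear : linear S.
Proof.
move=> a f g.
apply: (@cvg_unique_normed R H _ (@finite_sets I) _
          (partial_sum (X ^~ (a *: f + g)))).
  exact: cvg_series.
have -> : partial_sum (X ^~ (a *: f + g)) =
    (a \*: partial_sum (X ^~ f)) + partial_sum (X ^~ g).
  by apply/funext => F; exact: partial_sum_linear.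
by apply: cvgD; [apply: cvgZl_tmp|]; exact: cvg_series.
Qed.

Lemma inner_series f : inner (S f) f = usum (form f).
Proof.
apply: (@cvg_unique_normed R R[i]^o _ (@finite_sets I) _
          (partial_sum (form f))); last exact: form_cvg.
have -> : partial_sum (form f) = fun F => inner (partial_sum (X ^~ f) F) f.
  by apply/funext => F; rewrite inner_suml.
by apply: cvg_inner; exact: cvg_series.
Qed.

(** [form_le] compares in [R[i]] with a real number, so it already says that the form is real. *)
Lemma series_sym f g : rdot (S f) g = rdot f (S g).
Proof.
apply: (rdot_sym_of_real_form series_linear) => h; rewrite inner_series.
have := form_le h; rewrite normE -rmorphXn -rmorphM lecE => /andP[/eqP <- _].
by [].
Qed.

Lemma series_ge f : A * rnorm f ^+ 2 <= rdot (S f) f.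
Proof.
have := form_ge f; rewrite -inner_series normE -rmorphXn -rmorphM lecE.
by move=> /andP[].
Qed.

Lemma series_le f : rdot (S f) f <= B * rnorm f ^+ 2.
Proof.
have := form_le f; rewrite -inner_series normE -rmorphXn -rmorphM lecE.
by move=> /andP[].
Qed.

Let B0 : 0 < B. Proof. exact: lt_le_trans AB. Qed.

(* Expand [0 <= <S h, h>] at [h = f - S f / B]. *)
Lemma series_norm_le f : rnorm (S f) <= B * rnorm f.
Proof.
rewrite -(@ler_pXn2r _ 2) ?nnegrE ?mulr_ge0 ?rnorm_ge0 ?(ltW B0)// exprMn.
pose h := f - (B^-1)%:C *: S f.
have := series_ge h.
have : 0 <= A * rnorm h ^+ 2 by rewrite mulr_ge0 ?sqr_ge0 ?ltW.
rewrite /h (linear_opB series_linear) (linear_opZ series_linear).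
move=> h0 /(le_trans h0).
rewrite !rdotE (series_sym (S f) f) (rdotff (S f)).
have := series_le (S f); have := series_le f.
(* With these names, $B^2\langle Sh,h\rangle = B(Ba-2n+b/B) \ge 0$; since $b \le Bn$ and $a \le Bm$,
   $n \le Ba \le B^2m$. *)
move: (rdot (S f) f) (rdot (S (S f)) (S f)) (rnorm f ^+ 2) (rnorm (S f) ^+ 2).
move=> a b m n aM bM abn.
have := mulr_ge0 (sqr_ge0 B) abn.
have -> : B ^+ 2 * (a - B^-1 * n + (- (B^-1 * n) - - (B^-1 * (B^-1 * b)))) =
    B * (B * a - 2 * n + B^-1 * b) by field; rewrite gt_eqF.
rewrite pmulr_rge0//.
have : B^-1 * b <= n by rewrite ler_pdivrMl.
have : B * a <= B * (B * m) by rewrite ler_pM2l.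
by rewrite expr2; lra.
Qed.

(** Divide $A|f|^2 \le \mathrm{Re}\langle Sf,f\rangle \le |Sf||f|$ by $|f|$. *)
Lemma series_norm_ge f : A * rnorm f <= rnorm (S f).
Proof.
have := rnorm_ge0 f; rewrite le_eqVlt => /predU1P[<-|f0].
  by rewrite mulr0 rnorm_ge0.
rewrite -(ler_pM2r f0) (le_trans _ (ler_rdot _ _))// -mulrA.
exact: series_ge.
Qed.

Lemma series_inj f g : S f = S g -> f = g.
Proof.
move=> e; apply/eqP; rewrite -subr_eq0; apply/eqP/rnorm0_eq0/eqP.
rewrite eq_le rnorm_ge0 andbT -(pmulr_rle0 _ A0).
rewrite (le_trans (series_norm_ge _))//.
by rewrite (linear_opB series_linear) e subrr rnorm0.
Qed.

(** By [series_norm_ge], preimages of a convergent sequence in the range are Cauchy;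
    [series_norm_le] then identifies the image of their limit. *)
Lemma closed_range_series : closed_subspace (range S).
Proof.
split; last first.
- move=> a _ _ [f _ <-] [g _ <-].
  by exists (a *: f + g) => //; rewrite series_linear.
- by exists 0 => //; rewrite (linear_op0 series_linear).
apply/closed_rnormP => y yS.
have /choice[f_ f_P] (n : nat) : exists f, rnorm (S f - y) < n.+1%:R^-1.
  have n0 : 0 < n.+1%:R^-1 :> R by rewrite invr_gt0.
  by have [_ [f _ <-] fy] := yS _ n0; exists f.
have /cvg_ex[f /cvg_rnormP ff] : cvg (f_ n @[n --> \oo]).
  apply: complete_rnorm => e e0.
  have e20 : 0 < A * e / 2 by rewrite divr_gt0 ?mulr_gt0.
  have [N NP] := exists_natSinv_lt e20.
  exists [set n | (N <= n)%N]; first by exists N.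
  move=> i j /NP iN /NP jN; rewrite -(ltr_pM2l A0).
  apply: (le_lt_trans (series_norm_ge _)); rewrite (linear_opB series_linear).
  have := ler_rnorm_dist y (S (f_ i)) (S (f_ j)); rewrite (rnorm_distC y).
  by have := lt_trans (f_P i) iN; have := lt_trans (f_P j) jN; lra.
exists f => //; apply/eqP; rewrite -subr_eq0; apply/eqP/rnorm0_eq0/eqP.
rewrite eq_le rnorm_ge0 andbT; apply/ler_addgt0Pr => e e0; rewrite add0r.
have e20 : 0 < e / 2 by lra.
have eB0 : 0 < e / 2 / B by rewrite divr_gt0.
have [N NP] := exists_natSinv_lt e20; have [M _ MP] := ff _ eB0.
have fyn := lt_trans (f_P (maxn N M)) (NP _ (leq_maxl N M)).
have : rnorm (f_ (maxn N M) - f) < e / 2 / B := MP _ (leq_maxr N M).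
rewrite ltr_pdivlMr// mulrC => fn.
have := le_lt_trans (series_norm_le _) fn.
rewrite (linear_opB series_linear) rnorm_distC.
by have := ler_rnorm_dist (S (f_ (maxn N M))) (S f) y; lra.
Qed.

(** The part [h] of [g] orthogonal to the range satisfies $\mathrm{Re}\langle Sh,h\rangle = 0$, so
    coercivity kills it. *)
Lemma series_surj g : exists f, S f = g.
Proof.
have [[f _ fg] gP] := orthogonal_projP closed_range_series g.
exists f; rewrite fg; apply/esym/eqP; rewrite -subr_eq0.
apply/eqP/rnorm0_eq0/eqP.
set h := g - _ in gP *.
have : rdot (S h) h = 0 by rewrite rdotC /rdot gP//; exists h.
have := series_ge h => /[swap] ->.
by rewrite pmulr_rle0// => hh; rewrite -sqrf_eq0 eq_le hh sqr_ge0.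
Qed.

Lemma inverse_seriesK g : S (inverse_op S g) = g.
Proof. exact: (@xgetPex _ 0 [set f | S f = g] (series_surj g)). Qed.

Lemma bounded_inverse_series : bounded_operator (inverse_op S).
Proof.
apply/bounded_operatorP; split.
  by move=> a f g; apply: series_inj; rewrite series_linear !inverse_seriesK.
exists A^-1 => [|f]; first by rewrite invr_ge0 ltW.
by rewrite ler_pdivlMl// (le_trans (series_norm_ge _))// inverse_seriesK.
Qed.

End CoerciveSeries.

(** * The resolution of the identity and its bounds *)

Theorem theorem4p1 (R : realType) (H : hilbertType R) (J : set int)
    (Hj : J -> hilbertType R) (W : J -> set H) (v : J -> R)
    (Lam : forall j : J, H -> Hj j) (T U : H -> H) (A B : R)
    (H_separable : separable_space H)
    (W_closed : forall j, closed_subspace (W j))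
    (v_pos : forall j, 0 < v j)
    (Lam_bounded : forall j, bounded_operator (Lam j))
    (T_inv : bounded_invertible T)
    (U_inv : bounded_invertible U)
    (frame : controlled_gfusion_frame T U W Lam v A B) :
  let Sinv := inverse_op (frame_operator T U W Lam v) in
  (forall f, Sinv (T f) = T (Sinv f)) ->
  (forall f, Sinv (U f) = U (Sinv f)) ->
  let Tj := fun (j : J) (f : H) =>
    Lam j (orthogonal_proj (W j) (Sinv f)) in
  resolution_of_identity (fun (j : J) (f : H) => (v j ^+ 2)%:C *:
    adjoint T (orthogonal_proj (W j) (adjoint (Lam j) (Tj j (U f)))))
  /\ forall f : H,
     let term := fun j : J =>
       (v j ^+ 2)%:C * inner (Tj j (U f)) (Tj j (T f)) : R[i]^o in
     [/\ unconditionally_converges term,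
         (A / B ^+ 2)%:C * `|f| ^+ 2 <= usum term
       & usum term <= (B / A ^+ 2)%:C * `|f| ^+ 2].
Proof.
move=> Sinv SinvT SinvU Tj.
have [A0 AB fr] := frame.
have B0 : 0 < B by exact: lt_le_trans AB.
have Tb : bounded_operator T by case: T_inv.
have Ub : bounded_operator U by case: U_inv.
pose X (j : J) (f : H) := (v j ^+ 2)%:C *: adjoint T (orthogonal_proj (W j)
  (adjoint (Lam j) (Lam j (orthogonal_proj (W j) (U f))))).
have Pb j := bounded_orthogonal_proj (W_closed j).
have Xb j : bounded_operator (X j).
  apply/bounded_scale/(bounded_comp (bounded_adjoint Tb)).
  apply: (bounded_comp (Pb j)).
  apply: (bounded_comp (bounded_adjoint (Lam_bounded j))).
  by apply: (bounded_comp (Lam_bounded j)); exact: (bounded_comp (Pb j)).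
have XL j : linear (X j) by case: (Xb j).
(* Moving [adjoint T], the projection and [adjoint (Lam j)] to the second argument recovers the
   frame term. *)
have formE f :
    (fun j => inner (X j f) f : R[i]^o) = controlled_term T U W Lam v f.
  apply/funext => j; rewrite /controlled_term /X innerZl; congr (_ * _).
  rewrite (adjointPl Tb) (orthogonal_proj_selfadjoint (W_closed j)).
  exact: adjointPl.
have form_cvg f : unconditionally_converges (fun j => inner (X j f) f : R[i]^o).
  by rewrite formE; case: (fr f).
have form_ge f : A%:C * `|f| ^+ 2 <= usum (fun j => inner (X j f) f : R[i]^o).
  by rewrite formE; case: (fr f).
have form_le f : usum (fun j => inner (X j f) f : R[i]^o) <= B%:C * `|f| ^+ 2.
  by rewrite formE; case: (fr f).
have SK g : frame_operator T U W Lam v (Sinv g) = g.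
  exact: (inverse_seriesK XL form_cvg A0 AB form_ge form_le).
have Sb : bounded_operator Sinv.
  exact: (bounded_inverse_series XL form_cvg A0 AB form_ge form_le).
have XE j f : (v j ^+ 2)%:C *: adjoint T (orthogonal_proj (W j)
    (adjoint (Lam j) (Tj j (U f)))) = X j (Sinv f).
  by rewrite /Tj SinvU.
split.
  split=> [j|f].
    under eq_fun do rewrite XE; exact: bounded_comp (Xb j) Sb.
  rewrite (_ : (fun j => _) = X ^~ (Sinv f)).
  2: by apply/funext => j; exact: XE.
  have := @cvg_series _ _ _ _ XL form_cvg (Sinv f).
  by rewrite -/(frame_operator T U W Lam v (Sinv f)) SK.
move=> f term.
(* Commutation with both [U] and [T] makes this the frame sum at [Sinv f]. *)
have -> : term = controlled_term T U W Lam v (Sinv f).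
  by apply/funext => j; rewrite /term /Tj SinvU SinvT.
have [cv ge le] := fr (Sinv f); split => //.
  (* The lower bound is $A|S_C^{-1}f|^2$ with $|f| \le B|S_C^{-1}f|$. *)
  apply: le_trans ge; rewrite !normE -!rmorphXn -!rmorphM lecR.
  have := series_norm_le XL form_cvg A0 AB form_ge form_le (Sinv f).
  rewrite -/(frame_operator T U W Lam v (Sinv f)) SK => fB.
  rewrite -mulrA ler_pM2l// ler_pdivrMl ?exprn_gt0// -exprMn.
  by rewrite ler_pXn2r ?nnegrE ?mulr_ge0 ?rnorm_ge0 ?(ltW B0).
(* The upper bound is $B|S_C^{-1}f|^2$ with $A|S_C^{-1}f| \le |f|$. *)
apply: (le_trans le); rewrite !normE -!rmorphXn -!rmorphM lecR.
have := series_norm_ge XL form_cvg form_ge (Sinv f).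
rewrite -/(frame_operator T U W Lam v (Sinv f)) SK => fA.
rewrite -mulrA ler_pM2l// ler_pdivlMl ?exprn_gt0// -exprMn.
by rewrite ler_pXn2r ?nnegrE ?mulr_ge0 ?rnorm_ge0 ?(ltW A0).
Qed.
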